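(* Let $\mathcal{H}$ be a separable Hilbert space. Any countable family in $\mathcal{H}$ that contains a subfamily which is complete and minimal in $\mathcal{H}$ is a weighted lower semi frame for $\mathcal{H}$.
   Context: Let $\{f_n\}$ be a countable family in a separable Hilbert space $\mathcal{H}$ with inner product $\langle\cdot,\cdot\rangle$ and norm $\|\cdot\|$. The family is complete in $\mathcal{H}$ if its closed linear span is $\mathcal{H}$. It is minimal if each $f_n$ lies outside the closed linear span of the remaining elements. It is a weighted lower semi frame for $\mathcal{H}$ if there exist a constant $C>0$ and positive real numbers $c_n$ such that $C\|f\|^2\le\sum_n|\langle f,c_n f_n\rangle|^2$ for all $f\in\mathcal{H}$ (the sum may equal $+\infty$). *)

(* Defs.v *)
From HB Require Import structures.
From mathcomp Require Import all_boot all_order all_algebra.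
From mathcomp Require Import all_classical all_reals all_analysis.
From mathcomp Require Export complex.
Export numFieldNormedType.Exports.

Set Implicit Arguments.
Unset Strict Implicit.
Unset Printing Implicit Defensive.
Import Order.TTheory GRing.Theory Num.Theory.

Local Open Scope classical_set_scope.
Local Open Scope ring_scope.

(* A Hilbert space may be real or complex; both cases are treated uniformly,
   with scalars R or R[i] over the reals R. *)
Inductive scalar_kind := RealScalars | ComplexScalars.

Definition scalars (R : realType) (k : scalar_kind) : numFieldType :=
  match k with
  | RealScalars => R
  | ComplexScalars => R[i]
  end.

Definition scalar_conj (R : realType) (k : scalar_kind) :
    scalars R k -> scalars R k :=
  match k with
  | RealScalars => idfun
  | ComplexScalars => @Num.conj R[i]
  end.

(* Norms on a vector space over K take their values in K; for K = R[i] these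
   values have zero imaginary part, and [real_part] turns them into elements
   of R. *)
Definition real_part (R : realType) (k : scalar_kind) : scalars R k -> R :=
  match k with
  | RealScalars => idfun
  | ComplexScalars => @complex.Re R
  end.

Definition separable (T : topologicalType) : Prop :=
  exists2 D : set T, countable D & dense D.

Section Families.
Variables (R : realType) (k : scalar_kind).
Local Notation K := (scalars R k).
Variable H : normedModType K.

Definition linear_span (A : set H) : set H :=
  [set x | exists (n : nat) (a : 'I_n -> K) (v : 'I_n -> H),
     (forall i, A (v i)) /\ x = \sum_(i < n) a i *: v i].

Definition closed_span (A : set H) : set H := closure (linear_span A).

(* Families are functions on an index type; a subfamily is given by a set J of
   indices, so that repeated vectors count as distinct members. *)
Definition complete_subfamily (I : Type) (f : I -> H) (J : set I) : Prop :=
  closed_span (f @` J) = [set: H].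

Definition minimal_subfamily (I : Type) (f : I -> H) (J : set I) : Prop :=
  forall n, J n -> ~ closed_span (f @` (J `\ n)) (f n).

(* The order on R[i] makes [0 < c n] mean that c n is real and positive. *)
Definition weighted_lower_semi_frame (ip : H -> H -> K) (I : choiceType)
    (f : I -> H) : Prop :=
  exists (C : R) (c : I -> K),
    [/\ 0 < C, forall n, 0 < c n &
      forall x : H,
        ((C * real_part `|x| ^+ 2)%:E <=
         \esum_(n in [set: I]) (real_part `|ip x (c n *: f n)| ^+ 2)%:E)%E].

End Families.

(* Main.v *)
Require Import Defs.
From HB Require Import structures.
From mathcomp Require Import all_boot all_order all_algebra.
From mathcomp Require Import all_classical all_reals all_analysis.
From mathcomp Require Import ring.

Local Open Scope classical_set_scope.
Local Open Scope ring_scope.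
Import Order.TTheory GRing.Theory Num.Theory.

Set Implicit Arguments.
Unset Strict Implicit.
Unset Printing Implicit Defensive.

(** Let J be the complete and minimal subfamily.  Minimality gives every f n
    with n in J a distance d n > 0 to the span of the other members, and the
    weights c n = 2 ^ (pickle n) / d n work, with constant 1/4.  Off J the
    weights are arbitrary, since the terms there only enlarge the sum.

    The idea is a duality argument.  If y = \sum_n b n *: f n is a finite
    combination over J, then |b n| * d n <= |y|, because y is b n times the
    difference of f n and a vector spanned by the other members
    ([coef_le_norm]).  Let S be the square root of the weighted sum for x, if it
    is finite.  Each of its terms gives |<x, f n>| <= S * 2 ^ -(pickle n) * d n,
    so that
      |<x, y>| <= \sum_n |b n| * |<x, f n>| <= S * |y| * \sum_n 2 ^ -(pickle n)
               <= 2 * S * |y|.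
    By completeness such y come arbitrarily close to x, hence |x| <= 2 * S
    ([norm_le_of_ip_le]); the limit is taken in the expansion of |x - y|^2
    ([normB_ip_le]). *)

(** * Sums of powers of one half over a countable type *)

Lemma sum_half_pickle_le2 (K : numFieldType) (I : countType) (s : seq I) :
  uniq s -> \sum_(i <- s) 2^-1 ^+ pickle i <= 2 :> K.
Proof.
move=> us; set t := map pickle s; pose N := (\max_(m <- t) m).+1.
rewrite -(big_map pickle xpredT (fun m => 2^-1 ^+ m : K)) -/t.
have ut : uniq t by rewrite map_inj_uniq//; exact: (pcan_inj pickleK).
have subt : {subset t <= iota 0 N}.
  by move=> m tm; rewrite mem_iota ltnS; exact: leq_bigmax_seq.
have geom n : \sum_(0 <= m < n) 2^-1 ^+ m = 2 - 2 * 2^-1 ^+ n :> K.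
  elim: n => [|n IH]; first by rewrite big_nil expr0 mulr1 subrr.
  by rewrite big_nat_recr//= IH exprS mulrA divff ?pnatr_eq0//; ring.
apply: (@le_trans _ _ (\sum_(m <- iota 0 N) 2^-1 ^+ m)); last first.
  have := geom N; rewrite /index_iota subn0 => ->.
  by rewrite gerBl mulr_ge0// exprn_ge0// invr_ge0.
rewrite [leRHS](perm_big (t ++ [seq m <- iota 0 N | m \notin t])); last first.
  apply: uniq_perm; rewrite ?iota_uniq//.
    rewrite cat_uniq ut filter_uniq ?iota_uniq// andbT.
    by apply/hasPn => m; rewrite mem_filter => /andP[].
  move=> m; rewrite mem_cat mem_filter.
  by case: (boolP (m \in t)) => //= tm; exact: subt.
by rewrite big_cat/= lerDl sumr_ge0// => m _; rewrite exprn_ge0// invr_ge0.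
Qed.

(** * Finite linear combinations of a family *)

Section Span.
Variables (R : realType) (k : scalar_kind).
Local Notation K := (scalars R k).
Variable H : normedModType K.

Lemma sum_in_linear_span (I : eqType) (f : I -> H) (J : set I) (b : I -> K) s :
  (forall m, m \in s -> J m) -> linear_span (f @` J) (\sum_(m <- s) b m *: f m).
Proof.
case: s => [_|x0 s sJ].
  exists 0%N, (fun=> 0), (fun=> 0); split; first by case.
  by rewrite big_nil big_ord0.
set t := x0 :: s.
exists (size t), (fun i => b (nth x0 t i)), (fun i => f (nth x0 t i)).
split=> [i|]; first by apply: imageP; apply: sJ; exact: mem_nth.
by rewrite (big_nth x0) big_mkord.
Qed.

(** Grouping the terms by index yields a well-defined coefficient of each f m;
    the coefficient estimate below fails for sums with repeated indices. *)
Lemma linear_span_uniq_sum (I : choiceType) (f : I -> H) (J : set I) y :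
  linear_span (f @` J) y ->
  exists (s : seq I) (b : I -> K), [/\ uniq s, (forall m, m \in s -> J m) &
    y = \sum_(m <- s) b m *: f m].
Proof.
move=> [n [a [v [vJ ->]]]].
have /choice[j jP] : forall i, exists m, J m /\ f m = v i.
  by move=> i; have [m Jm fm] := vJ i; exists m.
exists (undup (map j (enum 'I_n))), (fun m => \sum_(i | j i == m) a i).
split=> [|m|]; first exact: undup_uniq.
  by rewrite mem_undup => /mapP[i _ ->]; case: (jP i).
under [RHS]eq_bigr => m _ do rewrite scaler_suml.
rewrite (exchange_big_dep xpredT)//=; apply: eq_bigr => i _.
rewrite -big_filter.
rewrite (_ : seq.filter _ _ = [:: j i]) ?big_seq1 ?(jP i).2//.
under seq.eq_filter => m do rewrite eq_sym.
by rewrite filter_pred1_uniq ?undup_uniq// mem_undup map_f// mem_enum.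
Qed.

Lemma closed_spanPn (A : set H) v : ~ closed_span A v ->
  exists2 d : K, 0 < d & forall z, linear_span A z -> d <= `|v - z|.
Proof.
move=> /existsNP[B /not_implyP[/nbhs_normP[d /= d0 dB] AB]]; exists d => // z Az.
(* The order of K is partial, so real_leNgt needs both sides to be real. *)
rewrite real_leNgt ?normr_real ?gtr0_real//; apply/negP => zd.
by apply: AB; exists z; split=> //; apply: dB.
Qed.

(** If b n is nonzero, the sum is b n *: (f n - z) with z in the span of the
    other members.  This is the bound on the n-th coordinate functional that
    minimality provides. *)
Lemma coef_le_norm (I : choiceType) (f : I -> H) (J : set I) (b : I -> K) s n
    (d : K) : uniq s -> (forall m, m \in s -> J m) -> n \in s ->
  (forall z, linear_span (f @` (J `\ n)) z -> d <= `|f n - z|) ->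
  `|b n| * d <= `|\sum_(m <- s) b m *: f m|.
Proof.
move=> us sJ ns dP; have [->|bn0] := eqVneq (b n) 0.
  by rewrite normr0 mul0r.
rewrite (big_rem n)//=.
have -> : b n *: f n + \sum_(m <- rem n s) b m *: f m =
    b n *: (f n - \sum_(m <- rem n s) (- (b m / b n)) *: f m).
  rewrite scalerBr scaler_sumr -sumrN; congr (_ + _); apply: eq_bigr => m _.
  by rewrite scalerA -scaleNr mulrN opprK mulrCA divff// mulr1.
rewrite normrZ ler_wpM2l//; apply: dP; apply: sum_in_linear_span => m.
by rewrite mem_rem_uniq// inE => /andP[/eqP mn /sJ].
Qed.

End Span.

(** * Bounding a norm by inner products with a complete family *)

Section Dot.
Variables (R : realType) (k : scalar_kind).
Local Notation K := (scalars R k).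
Variable H : normedModType K.
Variable ip : {dot H for @scalar_conj R k}.
Hypothesis ip_norm : forall x : H, `|x| ^+ 2 = ip x x.

Lemma norm_scalar_conj (a : K) : `|scalar_conj a| = `|a|.
Proof. by case: k a => //= a; exact: norm_conjC. Qed.

Lemma norm_ipC x y : `|ip x y| = `|ip y x|.
Proof.
(* The sign is part of the definition of hermitian forms. *)
have -> : ip x y = (-1) ^+ false * scalar_conj (ip y x).
  exact: hermitian_subproof.
by rewrite expr0 mul1r norm_scalar_conj.
Qed.

Lemma norm_ipZr a x y : `|ip x (a *: y)| = `|a| * `|ip x y|.
Proof. by rewrite linearZr_LR normrM norm_scalar_conj. Qed.

(** Expansion of |x - y|^2.  It replaces the continuity of the inner product
    when x is approximated by vectors y. *)
Lemma normB_ip_le x y :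
  `|x| ^+ 2 + `|y| ^+ 2 <= 2 * `|ip x y| + `|x - y| ^+ 2.
Proof.
have dist2 : `|x - y| ^+ 2 = `|x| ^+ 2 + `|y| ^+ 2 - (ip x y + ip y x).
  by rewrite !ip_norm linearBl !linearBr; ring.
have real_sum : ip x y + ip y x \is Num.real.
  have -> : ip x y + ip y x = `|x| ^+ 2 + `|y| ^+ 2 - `|x - y| ^+ 2.
    by rewrite dist2; ring.
  by rewrite !(realB, realD)// realX// normr_real.
rewrite dist2 addrCA -[leLHS]addr0 lerD2l subr_ge0.
rewrite (le_trans (real_ler_norm real_sum))// (le_trans (ler_normD _ _))//.
by rewrite (norm_ipC y) mulr2n mulrDl mul1r.
Qed.

(** The bound on the inner products with the members of J extends to
    |<x, y>| <= 2 * S * |y| for y in the span, and then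
    |x|^2 + (|y| - 2 * S)^2 <= (2 * S)^2 + |x - y|^2, with |x - y| as small as
    desired.  The factor 2 is \sum_i 2 ^ -i. *)
Lemma norm_le_of_ip_le (I : countType) (f : I -> H) (J : set I) (d : I -> K)
    (S : K) (x : H) :
  (forall n, J n ->
     forall z, linear_span (f @` (J `\ n)) z -> d n <= `|f n - z|) ->
  closed_span (f @` J) x -> 0 <= S ->
  (forall n, J n -> `|ip x (f n)| <= S * 2^-1 ^+ pickle n * d n) ->
  `|x| ^+ 2 <= (2 * S) ^+ 2.
Proof.
move=> dP xJ S0 xS; apply/ler_addgt0Pr => e e0.
(* This r lies below both 1 and e, so that r ^+ 2 <= e. *)
pose r := e / (1 + e).
have e1 : 0 < 1 + e by rewrite addr_gt0.
have r0 : 0 < r by rewrite divr_gt0.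
have r1 : r <= 1 by rewrite ler_pdivrMr// mul1r lerDr.
have re : r ^+ 2 <= e.
  rewrite expr2 (le_trans (ler_piMl (ltW r0) r1))//.
  by rewrite ler_pdivrMr// ler_peMr ?ltW// ltrDl.
have [_ [/linear_span_uniq_sum[s [b [us sJ ->]]] xy]] : exists y,
    linear_span (f @` J) y /\ `|x - y| < r.
  have /xJ[y [yJ xy]] : nbhs x [set y | `|x - y| < r].
    by apply/nbhs_normP; exists r.
  by exists y.
set y := \sum_(m <- s) b m *: f m in xy *.
have ipy : `|ip x y| <= 2 * S * `|y|.
  rewrite linear_sum (le_trans (ler_norm_sum _ _ _))//.
  apply: (@le_trans _ _ (\sum_(m <- s) 2^-1 ^+ pickle m * (S * `|y|))).
    rewrite big_seq [leRHS]big_seq; apply: ler_sum => m ms.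
    have Jm := sJ _ ms.
    rewrite norm_ipZr (le_trans (ler_wpM2l (normr_ge0 _) (xS m Jm)))//.
    have -> : `|b m| * (S * 2^-1 ^+ pickle m * d m) =
      2^-1 ^+ pickle m * (S * (`|b m| * d m)) by ring.
    rewrite ler_wpM2l ?exprn_ge0 ?invr_ge0// ler_wpM2l//.
    exact: coef_le_norm us sJ ms (dP m Jm).
  by rewrite -mulr_suml -mulrA ler_wpM2r ?mulr_ge0// sum_half_pickle_le2.
have xyr : `|x - y| ^+ 2 <= e.
  by apply: le_trans re; rewrite ler_sqr ?nnegrE ?(ltW r0) ?(ltW xy).
have yS : 0 <= (`|y| - 2 * S) ^+ 2.
  by rewrite -realEsqr realB ?normr_real ?realM ?ger0_real.
apply: (@le_trans _ _ (`|x| ^+ 2 + (`|y| - 2 * S) ^+ 2));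
  first by rewrite lerDl.
have -> : `|x| ^+ 2 + (`|y| - 2 * S) ^+ 2 =
   `|x| ^+ 2 + `|y| ^+ 2 - 2 * (2 * S * `|y|) + (2 * S) ^+ 2 by ring.
rewrite addrC lerD2l lerBlDl (le_trans (normB_ip_le x y))// lerD//.
by rewrite ler_wpM2l.
Qed.

End Dot.

(** * Passing between the reals and the scalars *)

Section RealPart.
Variables (R : realType) (k : scalar_kind).
Local Notation K := (scalars R k).

Definition of_real : R -> K :=
  match k return R -> scalars R k with
  | RealScalars => idfun
  | ComplexScalars => real_complex R
  end.

Lemma of_realM a b : of_real (a * b) = of_real a * of_real b.
Proof. by rewrite /of_real; case: k => //=; exact: rmorphM. Qed.

Lemma of_real_nat n : of_real n%:R = n%:R.
Proof. by rewrite /of_real; case: k => //=; exact: rmorph_nat. Qed.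

Lemma ler_of_real a b : (of_real a <= of_real b) = (a <= b).
Proof. by rewrite /of_real; case: k => //=; exact: lecR. Qed.

Lemma of_real_ge0 a : (0 <= of_real a) = (0 <= a).
Proof. by rewrite -(ler_of_real 0) -[0%R in RHS]/(0%:R) of_real_nat. Qed.

Lemma real_partK (z : K) : 0 <= z -> of_real (real_part z) = z.
Proof.
by rewrite /of_real /real_part; case: k z => //= z /ger0_real/RRe_real.
Qed.

Lemma real_part_ge0 (z : K) : 0 <= z -> 0 <= real_part z.
Proof. by move=> z0; rewrite -of_real_ge0 real_partK. Qed.

End RealPart.

(** * The weighted lower semi frame inequality *)

Unset Implicit Arguments.

Theorem corollary1p2 (R : realType) (k : scalar_kind)
    (H : completeNormedModType (scalars R k))
    (ip : {dot H for @scalar_conj R k})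
    (ip_norm : forall x : H, `|x| ^+ 2 = ip x x)
    (H_separable : separable H)
    (I : countType) (f : I -> H)
    (f_sub : exists J : set I, complete_subfamily f J /\ minimal_subfamily f J) :
  weighted_lower_semi_frame ip f.
Proof.
case: f_sub => J [Jcomplete Jminimal].
have /choice[d dP] : forall n, exists d : scalars R k, 0 < d /\
    (J n -> forall z, linear_span (f @` (J `\ n)) z -> d <= `|f n - z|).
  move=> n; have [Jn|nJ] := pselect (J n); last by exists 1; split.
  by have [d d0 dP] := closed_spanPn (Jminimal n Jn); exists d.
have d0 n : 0 < d n by case: (dP n).
have c0 n : 0 < 2 ^+ pickle n / d n by rewrite divr_gt0// exprn_gt0.
exists (4^-1), (fun n => 2 ^+ pickle n / d n); split => // x.
set T := (\esum_(_ in _) _)%E.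
have T_term n :
    ((real_part `|ip x ((2 ^+ pickle n / d n) *: f n)| ^+ 2)%:E <= T)%E.
  apply: esum_ge; exists [set n]; last by rewrite fsbig_set1.
  by split=> //; exact: finite_set1.
have T0 : (0 <= T)%E by apply: esum_ge0 => n _; rewrite lee_fin sqr_ge0.
case: T T0 T_term => [t||//] => [t0 T_term|_ _]; last by rewrite leey.
rewrite lee_fin in t0; rewrite lee_fin.
pose S : scalars R k := of_real k (Num.sqrt t).
have S0 : 0 <= S by rewrite of_real_ge0 sqrtr_ge0.
have : `|x| ^+ 2 <= (2 * S) ^+ 2.
  apply: (norm_le_of_ip_le ip_norm (f := f) (J := J) (d := d)) => //.
  - by move=> n; case: (dP n).
  - by rewrite Jcomplete.
  move=> n Jn; have := T_term n; rewrite lee_fin.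
  rewrite -[leRHS]sqr_sqrtr// ler_sqr ?nnegrE ?sqrtr_ge0 ?real_part_ge0//.
  rewrite -(ler_of_real k) real_partK// norm_ipZr (gtr0_norm (c0 n)).
  rewrite -ler_pdivlMl// => /le_trans; apply.
  by rewrite invf_div exprVn [leLHS]mulrC [d n / _]mulrC mulrA.
rewrite ler_sqr ?nnegrE ?mulr_ge0// => xS.
have {}xS : real_part `|x| <= 2 * Num.sqrt t.
  by rewrite -(ler_of_real k) real_partK// of_realM of_real_nat.
rewrite ler_pdivrMl// -[t in leRHS]sqr_sqrtr//.
have -> : 4 * Num.sqrt t ^+ 2 = (2 * Num.sqrt t) ^+ 2 by ring.
by rewrite ler_sqr ?nnegrE ?mulr_ge0 ?sqrtr_ge0 ?real_part_ge0.
Qed.
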